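(* A De Morgan clone $\mathsf C$ with $\mathsf{DMA}\subseteq\mathsf C$ contains a non-harmonious function if and only if it contains $\mathrm{mnh}^2_1$ or $\mathrm{mnh}^2_2$.
   Context: Let $\mathrm{DM}_4=\{\mathsf t,\mathsf f,\mathsf n,\mathsf b\}$. The truth order $\le$ has $\mathsf f$ least, $\mathsf t$ greatest, $\mathsf n,\mathsf b$ incomparable; $\wedge,\vee$ are its meet and join. De Morgan negation: $-\mathsf t=\mathsf f$, $-\mathsf f=\mathsf t$, $-\mathsf n=\mathsf n$, $-\mathsf b=\mathsf b$. Conflation: $\partial\mathsf t=\mathsf t$, $\partial\mathsf f=\mathsf f$, $\partial\mathsf n=\mathsf b$, $\partial\mathsf b=\mathsf n$. A De Morgan function is a map $\mathrm{DM}_4^n\to\mathrm{DM}_4$, $n\ge1$; a De Morgan clone is a set of such functions closed under composition and containing all projections; constants are unary constant functions. $\mathsf{DMA}$ is the clone generated by $\wedge,\vee,\mathsf t,\mathsf f,-$. A function $f$ is harmonious if $f(\partial\overline a)=\partial f(\overline a)$ for all tuples $\overline a$ ($\partial$ applied componentwise). The binary functions $\mathrm{mnh}^2_1,\mathrm{mnh}^2_2$ are given as follows, listing for each first argument $x$ the values at $y=\mathsf t,\mathsf f,\mathsf n,\mathsf b$: $\mathrm{mnh}^2_1$: $x=\mathsf t,\mathsf f,\mathsf b$: $\mathsf f,\mathsf f,\mathsf n,\mathsf b$; $x=\mathsf n$: $\mathsf f,\mathsf f,\mathsf n,\mathsf f$. $\mathrm{mnh}^2_2$: $x=\mathsf t,\mathsf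 f,\mathsf n$: $\mathsf f,\mathsf f,\mathsf n,\mathsf b$; $x=\mathsf b$: $\mathsf f,\mathsf f,\mathsf f,\mathsf b$. *)

(* Defs.v *)
From HB Require Import structures.
From mathcomp Require Import all_boot all_order.

Set Implicit Arguments.
Unset Strict Implicit.
Unset Printing Implicit Defensive.

Inductive DM4 : Type := DMt | DMf | DMn | DMb.

Definition DM4_encode (x : DM4) : bool * bool :=
  match x with
  | DMt => (true, false) | DMf => (false, true)
  | DMn => (false, false) | DMb => (true, true)
  end.

Definition DM4_decode (p : bool * bool) : DM4 :=
  match p with
  | (true, false) => DMt | (false, true) => DMf
  | (false, false) => DMn | (true, true) => DMb
  end.

Lemma DM4_encodeK : cancel DM4_encode DM4_decode.
Proof. by case. Qed.

HB.instance Definition _ := Finite.copy DM4 (can_type DM4_encodeK).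

Definition DM4_le (x y : DM4) : bool := [|| x == y, x == DMf | y == DMt].

Definition DM4_lt (x y : DM4) : bool := (y != x) && DM4_le x y.

Definition DM4_meet (x y : DM4) : DM4 :=
  if DM4_le x y then x else if DM4_le y x then y else DMf.

Definition DM4_join (x y : DM4) : DM4 :=
  if DM4_le x y then y else if DM4_le y x then x else DMt.

Fact DM4_display : Order.disp_t.
Proof. exact: Order.Disp tt tt. Qed.

Fact DM4_le_def x y : DM4_le x y = (DM4_meet x y == x).
Proof. by case: x; case: y. Qed.

Fact DM4_lt_def x y : DM4_lt x y = (y != x) && DM4_le x y.
Proof. by []. Qed.

Fact DM4_meetC : commutative DM4_meet.
Proof. by case; case. Qed.

Fact DM4_joinC : commutative DM4_join.
Proof. by case; case. Qed.

Fact DM4_meetA : associative DM4_meet.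
Proof. by case; case; case. Qed.

Fact DM4_joinA : associative DM4_join.
Proof. by case; case; case. Qed.

Fact DM4_joinKI y x : DM4_meet x (DM4_join x y) = x.
Proof. by case: x; case: y. Qed.

Fact DM4_meetKU y x : DM4_join x (DM4_meet x y) = x.
Proof. by case: x; case: y. Qed.

Fact DM4_meetUl : left_distributive DM4_meet DM4_join.
Proof. by case; case; case. Qed.

Fact DM4_meetxx : idempotent_op DM4_meet.
Proof. by case. Qed.

HB.instance Definition _ := Order.isMeetJoinDistrLattice.Build DM4_display DM4
  DM4_le_def DM4_lt_def DM4_meetC DM4_joinC DM4_meetA DM4_joinA
  DM4_joinKI DM4_meetKU DM4_meetUl DM4_meetxx.

Fact DM4_le0x (x : DM4) : (DMf <= x)%O.
Proof. by case: x. Qed.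

Fact DM4_lex1 (x : DM4) : (x <= DMt)%O.
Proof. by case: x. Qed.

HB.instance Definition _ := Order.hasBottom.Build DM4_display DM4 DM4_le0x.
HB.instance Definition _ := Order.hasTop.Build DM4_display DM4 DM4_lex1.

Definition dm_neg (x : DM4) : DM4 :=
  match x with DMt => DMf | DMf => DMt | DMn => DMn | DMb => DMb end.

Definition conflation (x : DM4) : DM4 :=
  match x with DMt => DMt | DMf => DMf | DMn => DMb | DMb => DMn end.

(* Finite functions, so that Leibniz equality is extensional equality. The    *)
(* arity 0 is excluded in [is_clone].                                         *)
Definition DMfun (n : nat) : Type := {ffun n.-tuple DM4 -> DM4}.

Definition fun1 (h : DM4 -> DM4) : DMfun 1 :=
  [ffun a : 1.-tuple DM4 => h (tnth a ord0)].

Definition fun2 (h : DM4 -> DM4 -> DM4) : DMfun 2 :=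
  [ffun a : 2.-tuple DM4 => h (tnth a ord0) (tnth a ord_max)].

Definition dm_proj (n : nat) (i : 'I_n) : DMfun n :=
  [ffun a : n.-tuple DM4 => tnth a i].

Definition dm_comp (n m : nat) (f : DMfun n) (g : 'I_n -> DMfun m) : DMfun m :=
  [ffun a : m.-tuple DM4 => f [tuple g i a | i < n]].

Definition DMfamily : Type := forall n : nat, DMfun n -> Prop.

Definition subfamily (A B : DMfamily) : Prop :=
  forall (n : nat) (f : DMfun n), A n f -> B n f.

Record is_clone (C : DMfamily) : Prop := IsClone {
  clone_arity : forall (n : nat) (f : DMfun n), C n f -> 0 < n;
  clone_proj : forall (n : nat) (i : 'I_n), C n (dm_proj i);
  clone_comp : forall (n m : nat) (f : DMfun n) (g : 'I_n -> DMfun m),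
    C n f -> (forall i : 'I_n, C m (g i)) -> C m (dm_comp f g)
}.

Definition generated_clone (G : DMfamily) : DMfamily :=
  fun n f => forall C : DMfamily, is_clone C -> subfamily G C -> C n f.

Inductive DMA_generator : DMfamily :=
  | DMA_meet : DMA_generator (fun2 (fun x y : DM4 => Order.meet x y))
  | DMA_join : DMA_generator (fun2 (fun x y : DM4 => Order.join x y))
  | DMA_t : DMA_generator (fun1 (fun=> DMt))
  | DMA_f : DMA_generator (fun1 (fun=> DMf))
  | DMA_neg : DMA_generator (fun1 dm_neg).

Definition DMA : DMfamily := generated_clone DMA_generator.

Definition harmonious (n : nat) (f : DMfun n) : Prop :=
  forall a : n.-tuple DM4, f (map_tuple conflation a) = conflation (f a).

Definition mnh1 : DMfun 2 := fun2 (fun x y =>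
  match x, y with
  | _, DMt => DMf
  | _, DMf => DMf
  | _, DMn => DMn
  | DMn, DMb => DMf
  | _, DMb => DMb
  end).

Definition mnh2 : DMfun 2 := fun2 (fun x y =>
  match x, y with
  | _, DMt => DMf
  | _, DMf => DMf
  | DMb, DMn => DMf
  | _, DMn => DMn
  | _, DMb => DMb
  end).

(* Main.v *)
Require Import Defs.
From mathcomp Require Import all_boot all_order.

Set Implicit Arguments.
Unset Strict Implicit.
Unset Printing Implicit Defensive.

(**
  If f(∂a) <> ∂f(a), substitute in f the constants for the classical entries
  of a, x for the entries n, and y for the entries b: the resulting binary
  function g satisfies g(b,n) <> ∂g(n,b).  Both mnh functions agree with
  y ∧ -y, except that mnh1 is DMf at (n,b) and mnh2 is DMf at (b,n).  The De Morgan
  term y ∧ -y ∧ (x ∨ -x) agrees with y ∧ -y except at both of these points,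
  where it is DMf.  Joining it with y ∧ -y ∧ g or y ∧ -y ∧ -g therefore only
  affects these two points, and checking the twelve possible pairs
  (g(n,b), g(b,n)) shows that one of the two joins is mnh1 or mnh2.
*)

Lemma clone_generator {C : DMfamily} (hDMA : subfamily DMA C) {n} (f : DMfun n) :
  DMA_generator f -> C n f.
Proof. by move=> gen_f; apply: hDMA => D _; apply. Qed.

Lemma clone_fun1 {C : DMfamily} (hC : is_clone C) {n}
    (h : DM4 -> DM4) (f : DMfun n) :
  C 1 (fun1 h) -> C n f -> C n [ffun a => h (f a)].
Proof.
move=> Ch Cf; have := clone_comp hC (g := fun=> f) Ch (fun=> Cf).
by congr (C n _); apply/ffunP=> a; rewrite !ffunE tnth_mktuple.
Qed.

Lemma clone_fun2 {C : DMfamily} (hC : is_clone C) {n}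
    (h : DM4 -> DM4 -> DM4) (f g : DMfun n) :
  C 2 (fun2 h) -> C n f -> C n g -> C n [ffun a => h (f a) (g a)].
Proof.
move=> Ch Cf Cg.
have Cfg (i : 'I_2) : C n (if i == ord0 then f else g) by case: ifP.
have := clone_comp hC Ch Cfg.
by congr (C n _); apply/ffunP=> a; rewrite !ffunE !tnth_mktuple.
Qed.

Lemma clone_neg {C : DMfamily} (hC : is_clone C)
    (hDMA : subfamily DMA C) {n} (f : DMfun n) : C n f -> C n [ffun a => dm_neg (f a)].
Proof. apply: (clone_fun1 hC); exact: clone_generator DMA_neg. Qed.

Lemma clone_meet {C : DMfamily} (hC : is_clone C)
    (hDMA : subfamily DMA C) {n} (f g : DMfun n) :
  C n f -> C n g -> C n [ffun a => Order.meet (f a) (g a)].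
Proof. apply: (clone_fun2 hC); exact: clone_generator DMA_meet. Qed.

Lemma clone_join {C : DMfamily} (hC : is_clone C)
    (hDMA : subfamily DMA C) {n} (f g : DMfun n) :
  C n f -> C n g -> C n [ffun a => Order.join (f a) (g a)].
Proof. apply: (clone_fun2 hC); exact: clone_generator DMA_join. Qed.

(** The generator is a unary constant, so arity [n] is reached by composing it with a projection;
    the index [i] supplies one and rules out [n = 0]. *)
Lemma clone_true {C : DMfamily} (hC : is_clone C)
    (hDMA : subfamily DMA C) {n} (i : 'I_n) : C n [ffun=> DMt].
Proof.
have := clone_fun1 hC (clone_generator hDMA DMA_t) (clone_proj hC i).
by congr (C n _); apply/ffunP=> a; rewrite !ffunE.
Qed.

Lemma clone_false {C : DMfamily} (hC : is_clone C)
    (hDMA : subfamily DMA C) {n} (i : 'I_n) : C n [ffun=> DMf].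
Proof.
have := clone_fun1 hC (clone_generator hDMA DMA_f) (clone_proj hC i).
by congr (C n _); apply/ffunP=> a; rewrite !ffunE.
Qed.

Definition binarizer (x : DM4) : DMfun 2 :=
  match x with
  | DMt => [ffun=> DMt]
  | DMf => [ffun=> DMf]
  | DMn => dm_proj ord0
  | DMb => dm_proj ord_max
  end.

Definition binarize {n} (f : DMfun n) (a : n.-tuple DM4) : DMfun 2 :=
  dm_comp f (fun i => binarizer (tnth a i)).

Lemma binarize_nb {n} (f : DMfun n) a :
  binarize f a [tuple DMn; DMb] = f a.
Proof.
rewrite ffunE; congr (f _); apply: eq_from_tnth => i.
by rewrite tnth_mktuple; case: (tnth a i); rewrite ffunE.
Qed.

(** Swapping the inputs n and b conflates the entries n and b of [a], while the constants put in for
    the classical entries are fixed by conflation. *)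
Lemma binarize_bn {n} (f : DMfun n) a :
  binarize f a [tuple DMb; DMn] = f (map_tuple conflation a).
Proof.
rewrite ffunE; congr (f _); apply: eq_from_tnth => i.
by rewrite tnth_mktuple tnth_map; case: (tnth a i); rewrite ffunE.
Qed.

Lemma clone_binarize {C : DMfamily} (hC : is_clone C)
    (hDMA : subfamily DMA C) {n} (f : DMfun n) a : C n f -> C 2 (binarize f a).
Proof.
move=> Cf; apply: (clone_comp hC) => // i.
case: (tnth a i) => /=; [exact: clone_true ord0 | exact: clone_false ord0 | |];
  exact: clone_proj.
Qed.

(** The nested [[ffun b => _] a] keep the term in the exact shape produced by [clone_neg],
    [clone_meet] and [clone_join]. *)
Definition mnh_term (g : DMfun 2) : DMfun 2 :=
  let x := dm_proj ord0 in
  let y := dm_proj ord_max in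
  let k : DMfun 2 := [ffun a => Order.meet (y a) ([ffun b => dm_neg (y b)] a)] in
  let e : DMfun 2 := [ffun a => Order.join (x a) ([ffun b => dm_neg (x b)] a)] in
  [ffun a => Order.join ([ffun b => Order.meet (k b) (e b)] a)
                        ([ffun b => Order.meet (k b) (g b)] a)].

Lemma clone_mnh_term {C : DMfamily} (hC : is_clone C)
    (hDMA : subfamily DMA C) (g : DMfun 2) : C 2 g -> C 2 (mnh_term g).
Proof.
move=> Cg; have Cp i : C 2 (dm_proj i) by exact: clone_proj.
by apply: clone_join => //; apply: clone_meet => //;
  [apply: clone_meet | apply: clone_join | apply: clone_meet] => //;
  apply: clone_neg.
Qed.

Lemma tuple2E (T : Type) (a : 2.-tuple T) :
  a = [tuple tnth a ord0; tnth a ord_max].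
Proof.
case: a => [[|x [|y [|z s]]]] // sz; apply: val_inj.
by rewrite /= !(tnth_nth x).
Qed.

Lemma mnh_term_eq_mnh1 (g : DMfun 2) :
  g [tuple DMn; DMb] \in [:: DMf; DMn] ->
  g [tuple DMb; DMn] \in [:: DMn; DMt] -> mnh_term g = mnh1.
Proof.
move=> gnb gbn; apply/ffunP=> a; rewrite (tuple2E a) !ffunE.
(* Wherever y ∧ -y lies below x ∨ -x, absorption removes [g]. Only (n,b) and (b,n) survive, in this
   order, with values b ∧ g(n,b) and n ∧ g(b,n). *)
case: (tnth a ord0) (tnth a ord_max) => [] [];
  try by case: (g _).
- by case: (g _) gnb.
- by case: (g _) gbn.
Qed.

Lemma mnh_term_eq_mnh2 (g : DMfun 2) :
  g [tuple DMn; DMb] \in [:: DMb; DMt] ->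
  g [tuple DMb; DMn] \in [:: DMf; DMb] -> mnh_term g = mnh2.
Proof.
move=> gnb gbn; apply/ffunP=> a; rewrite (tuple2E a) !ffunE.
case: (tnth a ord0) (tnth a ord_max) => [] [];
  try by case: (g _).
- by case: (g _) gnb.
- by case: (g _) gbn.
Qed.

(** A value p is determined by the tests b ≤ p and b ≤ -p, which conflation turns into n ≤ q and n ≤
    -q. So if q = g(b,n) is not the conflation of p = g(n,b), one of the tests separates them: the
    first makes [g] usable in [mnh_term], the second -g. *)
Lemma mnh_of_nonharmonious_pair {C : DMfamily} (hC : is_clone C)
    (hDMA : subfamily DMA C) (g : DMfun 2) :
  C 2 g -> g [tuple DMb; DMn] <> conflation (g [tuple DMn; DMb]) ->
  C 2 mnh1 \/ C 2 mnh2.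
Proof.
move=> Cg g_nh.
have C1 h : C 2 h -> h [tuple DMn; DMb] \in [:: DMf; DMn] ->
    h [tuple DMb; DMn] \in [:: DMn; DMt] -> C 2 mnh1 \/ C 2 mnh2.
  by move=> Ch hnb hbn; left; rewrite -(mnh_term_eq_mnh1 (g := h)) //;
    apply: clone_mnh_term.
have C2 h : C 2 h -> h [tuple DMn; DMb] \in [:: DMb; DMt] ->
    h [tuple DMb; DMn] \in [:: DMf; DMb] -> C 2 mnh1 \/ C 2 mnh2.
  by move=> Ch hnb hbn; right; rewrite -(mnh_term_eq_mnh2 (g := h)) //;
    apply: clone_mnh_term.
have Cn := clone_neg hC hDMA Cg.
have := C2 _ Cn; have := C1 _ Cn; have := C2 _ Cg; have := C1 _ Cg.
rewrite !ffunE; case: (g _) g_nh; case: (g _) => //= g_nh H1 H2 H3 H4;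
  by [apply: H1 | apply: H2 | apply: H3 | apply: H4].
Qed.

Lemma mnh1_not_harmonious : ~ harmonious mnh1.
Proof. by move/(_ [tuple DMn; DMb]); rewrite !ffunE. Qed.

Lemma mnh2_not_harmonious : ~ harmonious mnh2.
Proof. by move/(_ [tuple DMn; DMb]); rewrite !ffunE. Qed.

Theorem mainTheorem8 (C : DMfamily) (hC : is_clone C) (hDMA : subfamily DMA C) :
  (exists (n : nat) (f : DMfun n), C n f /\ ~ harmonious f) <->
  (C 2 mnh1 \/ C 2 mnh2).
Proof.
split=> [[n [f [Cf f_nh]]] | [Cm | Cm]]; first last.
- by exists 2, mnh2; split; last exact: mnh2_not_harmonious.
- by exists 2, mnh1; split; last exact: mnh1_not_harmonious.
(* Tuples are finitely many, so a boolean quantifier yields a failing tuple constructively. *)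
have /forallPn[a /eqP fa_nh] :
    ~~ [forall a, f (map_tuple conflation a) == conflation (f a)].
  by apply/negP => /forallP f_h; apply: f_nh => a; apply/eqP.
apply: (mnh_of_nonharmonious_pair hC hDMA (g := binarize f a)).
  exact: clone_binarize.
by rewrite binarize_nb binarize_bn.
Qed.
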